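(* Let $\mathbb{X}$ be a Cartesian tangent category with a curve object $(C,c_1,c_0)$. Suppose that $V_1$ and $V_2$ are vector fields on an object $M$ with associated flows $\gamma_1,\gamma_2:C\times M\to M$ (so each $V_i$ is complete and $\gamma_i$ is its solution). Then the following are equivalent: (i) the flows $\gamma_1,\gamma_2$ commute; (ii) $V_1$ is invariant under the flow of $V_2$; (iii) $V_2$ is invariant under the flow of $V_1$; (iv) $V_1$ and $V_2$ commute (as vector fields).
   Context: Composition is written in diagrammatic order: $fg$ means first $f$, then $g$. A tangent category is a category $\mathbb{X}$ with a functor $T:\mathbb{X}\to\mathbb{X}$ and natural transformations $p:T\to 1$, $0:1\to T$, $+:T_2\to T$, $\ell:T\to T^2$, $c:T^2\to T^2$ such that: (1) for all $M,n$ the fibre power $T_nM$ of $n$ copies of $p_M:TM\to M$ exists and is preserved by every $T^k$; (2) $(p_M,+_M,0_M)$ is an additive bundle, i.e. a commutative monoid in $\mathbb{X}/M$; (3) $(\ell_M,0_M)$ is an additive bundle morphism (commuting square preserving addition and zero) from $(p_M,+_M,0_M)$ to $(T(p_M),T(+_M),T(0_M))$, and $(c_M,1_{TM})$ is one from $(T(p_M),T(+_M),T(0_M))$ to $(p_{TM},+_{TM},0_{TM})$; (4) $cc=1$, $\ell c=\ell$, $\ell T(\ell)=\ell\ell_T$, $T(c)c_TT(c)=c_TT(c)c_T$, $\ell_TT(c)c_T=cT(\ell)$; (5) with $v:=\langle\pi_0\ell,\pi_10_{TM}\rangle T(+):T_2M\to T^2M$, the square $vT(p)=\pi_0p0$ exhibits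 $T_2M$ as the pullback of $T(p_M)$ along $0_M$, and this pullback is preserved by every $T^k$. It is Cartesian if it has finite products (terminal object $1$, unique maps to it written $!$) and $T$ preserves them; $T(A\times B)$ is identified with $TA\times TB$. Object subscripts are often omitted. A vector field on $M$ is a map $V:M\to TM$ with $Vp=1_M$. A dynamical system $(M,V,g)$ is a vector field $V$ on $M$ with a map $g:1\to M$. Given a fixed dynamical system $(C,c_1,c_0)$: a parameterized dynamical system (or system) $(M,V,g)$ is a vector field $V:M\to TM$ with a map $g:X\to M$; a solution of it is a map $\gamma:C\times X\to M$ with $\langle !c_0,1\rangle\gamma=g$ and $(c_1\times 0)T(\gamma)=\gamma V$. A curve object is a dynamical system $(C,c_1,c_0)$ such that: (Preinitial) every parameterized dynamical system has at most one solution; (Commutativity of $c_1$) $c_1T(c_1)c=c_1T(c_1)$; (Completeness of $c_1$) the system $(C,c_1,1_C)$ has a solution, denoted $\sigma:C\times C\to C$; $(C,\sigma,c_0)$ is then a commutative monoid. A vector field $V$ on $M$ is complete if every system $(M,V,g)$ has a solution (equivalently, $(M,V,1_M)$ has a solution); ''the solution of $V$'', or the flow associated to $V$, means the solution of $(M,V,1_M)$. A flow on $M$ is a map $\gamma:C\times M\to M$ with $\langle !c_0,1_M\rangle\gamma=1_M$ and $(\sigma\times 1)\gamma=(1\times\gamma)\gamma$; solutions of complete vector fields are flows. Vector fields $V_1,V_2$ on $M$ commute if $V_1T(V_2)c=V_2T(V_1)$. A vector field $V$ on $M$ is invariant under a flow $\gamma$ on $M$ if $\gamma V=(0\times V)T(\gamma)$.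 Flows $\gamma_1,\gamma_2$ on $M$ commute if $(\tau\times 1)(1\times\gamma_1)\gamma_2=(1\times\gamma_2)\gamma_1:C\times C\times M\to M$, where $\tau:=\langle\pi_1,\pi_0\rangle:C\times C\to C\times C$. *)

(* Defs.v *)
From mathcomp Require Import all_boot.

Set Implicit Arguments.
Unset Strict Implicit.
Unset Printing Implicit Defensive.

(** Categories, with composition in diagrammatic order. *)

Declare Scope cat_scope.
Delimit Scope cat_scope with cat.

Record category := Category {
  obj :> Type;
  hom : obj -> obj -> Type;
  idm : forall A, hom A A;
  comp : forall A B C, hom A B -> hom B C -> hom A C;
  comp1m : forall A B (f : hom A B), comp (idm A) f = f;
  compm1 : forall A B (f : hom A B), comp f (idm B) = f;
  compA : forall A B C D (f : hom A B) (g : hom B C) (h : hom C D),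
    comp f (comp g h) = comp (comp f g) h
}.
Arguments hom {_} A B.
Arguments idm {_} A.
Arguments comp {_ A B C} f g.

Notation "A ~> B" := (hom A B) (at level 99, B at level 200) : cat_scope.
Notation "f ;; g" := (comp f g) (at level 50, left associativity) : cat_scope.
Local Open Scope cat_scope.

Record functor (X Y : category) := Functor {
  fobj :> X -> Y;
  fmap : forall A B : X, (A ~> B) -> (fobj A ~> fobj B);
  fmap1 : forall A : X, fmap (idm A) = idm (fobj A);
  fmapM : forall (A B C : X) (f : A ~> B) (g : B ~> C),
    fmap (f ;; g) = fmap f ;; fmap g
}.
Arguments fmap {X Y} F {A B} f : rename.

Definition id_functor (X : category) : functor X X :=
  @Functor X X (fun A => A) (fun _ _ f => f)
    (fun _ => erefl) (fun _ _ _ _ _ => erefl).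

Lemma fmap1_comp (X Y Z : category) (F : functor X Y) (G : functor Y Z) A :
  fmap G (fmap F (idm A)) = idm (G (F A)).
Proof. by rewrite !fmap1. Qed.

Lemma fmapM_comp (X Y Z : category) (F : functor X Y) (G : functor Y Z)
    (A B C : X) (f : A ~> B) (g : B ~> C) :
  fmap G (fmap F (f ;; g)) = fmap G (fmap F f) ;; fmap G (fmap F g).
Proof. by rewrite !fmapM. Qed.

(** First [F], then [G]. *)
Definition comp_functor (X Y Z : category) (F : functor X Y)
    (G : functor Y Z) : functor X Z :=
  @Functor X Z (fun A => G (F A)) (fun _ _ f => fmap G (fmap F f))
    (@fmap1_comp X Y Z F G) (@fmapM_comp X Y Z F G).

Fixpoint iter_functor (X : category) (F : functor X X) (k : nat) :
    functor X X :=
  if k is k'.+1 then comp_functor (iter_functor F k') F else id_functor X.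

(** Universal properties.  The mediating maps are part of the data; being
    unique, they carry no choice. *)

Record is_terminal (X : category) (P : X) := IsTerminal {
  bang : forall Y : X, Y ~> P;
  bang_uniq : forall (Y : X) (u : Y ~> P), u = bang Y
}.

Record is_product (X : category) (A B P : X) (a : P ~> A) (b : P ~> B) :=
  IsProduct {
  prod_lift : forall Y : X, (Y ~> A) -> (Y ~> B) -> (Y ~> P);
  prod_lift0 : forall (Y : X) (f : Y ~> A) (g : Y ~> B),
    prod_lift f g ;; a = f;
  prod_lift1 : forall (Y : X) (f : Y ~> A) (g : Y ~> B),
    prod_lift f g ;; b = g;
  prod_uniq : forall (Y : X) (f : Y ~> A) (g : Y ~> B) (u : Y ~> P),
    u ;; a = f -> u ;; b = g -> u = prod_lift f g
}.

Record is_pullback (X : category) (A B C P : X) (f : A ~> C) (g : B ~> C)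
    (a : P ~> A) (b : P ~> B) := IsPullback {
  pb_sq : a ;; f = b ;; g;
  pb_lift : forall (Y : X) (h : Y ~> A) (k : Y ~> B),
    h ;; f = k ;; g -> (Y ~> P);
  pb_lift0 : forall (Y : X) (h : Y ~> A) (k : Y ~> B) (e : h ;; f = k ;; g),
    pb_lift e ;; a = h;
  pb_lift1 : forall (Y : X) (h : Y ~> A) (k : Y ~> B) (e : h ;; f = k ;; g),
    pb_lift e ;; b = k;
  pb_uniq : forall (Y : X) (h : Y ~> A) (k : Y ~> B) (e : h ;; f = k ;; g)
      (u : Y ~> P),
    u ;; a = h -> u ;; b = k -> u = pb_lift e
}.

(** [P] is the product of [n] copies of [q] in the slice over [M].  The
    structure map [b : P ~> M] is redundant unless [n = 0], where the fibre
    power is [M] itself. *)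
Record is_fibre_power (X : category) (E M : X) (q : E ~> M) (n : nat)
    (P : X) (b : P ~> M) (pr : 'I_n -> (P ~> E)) := IsFibrePower {
  fp_sq : forall i, pr i ;; q = b;
  fp_lift : forall (Y : X) (h : Y ~> M) (f : 'I_n -> (Y ~> E)),
    (forall i, f i ;; q = h) -> (Y ~> P);
  fp_lift_base : forall (Y : X) (h : Y ~> M) (f : 'I_n -> (Y ~> E))
      (e : forall i, f i ;; q = h),
    fp_lift e ;; b = h;
  fp_lift_pr : forall (Y : X) (h : Y ~> M) (f : 'I_n -> (Y ~> E))
      (e : forall i, f i ;; q = h) i,
    fp_lift e ;; pr i = f i;
  fp_uniq : forall (Y : X) (h : Y ~> M) (f : 'I_n -> (Y ~> E))
      (e : forall i, f i ;; q = h) (u : Y ~> P),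
    u ;; b = h -> (forall i, u ;; pr i = f i) -> u = fp_lift e
}.

Definition i0 {n : nat} : 'I_n.+1 := @Ordinal n.+1 0 isT.
Definition i1 {n : nat} : 'I_n.+2 := @Ordinal n.+2 1 isT.
Definition i2 {n : nat} : 'I_n.+3 := @Ordinal n.+3 2 isT.

Definition fam2 (A : Type) (a b : A) (i : 'I_2) : A :=
  if val i is 0 then a else b.

(** Additive bundles.  A [bundle] carries chosen fibre powers and the two
    operations as maps over the base; [is_additive] states the laws of a
    commutative monoid in the slice over the base. *)

Record bundle (X : category) := Bundle {
  b_tot : X;
  b_base : X;
  b_q : b_tot ~> b_base;
  b_pow : nat -> X;
  b_powq : forall n, b_pow n ~> b_base;
  b_pr : forall n, 'I_n -> (b_pow n ~> b_tot);
  b_powP : forall n, is_fibre_power b_q (b_powq n) (@b_pr n);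
  b_plus : b_pow 2 ~> b_tot;
  b_zero : b_base ~> b_tot;
  b_plus_q : b_plus ;; b_q = b_powq 2;
  b_zero_q : b_zero ;; b_q = idm b_base
}.
Arguments b_q {X} b.
Arguments b_powq {X} b n.
Arguments b_pr {X} b {n} i.
Arguments b_powP {X} b n.
Arguments b_plus {X} b.
Arguments b_zero {X} b.
Arguments b_plus_q {X} b.
Arguments b_zero_q {X} b.

Lemma fam2_q (X : category) (E M Y : X) (q : E ~> M) (f g : Y ~> E) :
  f ;; q = g ;; q -> forall i, fam2 f g i ;; q = f ;; q.
Proof. by move=> e [[|[|//]] ?]. Qed.

Definition b_pair (X : category) (A : bundle X) (Y : X) (f g : Y ~> b_tot A)
    (e : f ;; b_q A = g ;; b_q A) : Y ~> b_pow A 2 :=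
  fp_lift (b_powP A 2) (fam2_q e).

Definition b_add (X : category) (A : bundle X) (Y : X) (f g : Y ~> b_tot A)
    (e : f ;; b_q A = g ;; b_q A) : Y ~> b_tot A :=
  b_pair e ;; b_plus A.

Lemma b_add_q (X : category) (A : bundle X) (Y : X) (f g : Y ~> b_tot A)
    (e : f ;; b_q A = g ;; b_q A) : b_add e ;; b_q A = f ;; b_q A.
Proof. by rewrite /b_add -compA b_plus_q fp_lift_base. Qed.

Lemma b_pr_q (X : category) (A : bundle X) n (i j : 'I_n) :
  b_pr A i ;; b_q A = b_pr A j ;; b_q A.
Proof. by rewrite !(fp_sq (b_powP A n)). Qed.

Lemma b_q_zero_q (X : category) (A : bundle X) :
  idm (b_tot A) ;; b_q A = (b_q A ;; b_zero A) ;; b_q A.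
Proof. by rewrite comp1m -compA b_zero_q compm1. Qed.

Record is_additive (X : category) (A : bundle X) : Prop := IsAdditive {
  b_addA :
    b_add (etrans (b_add_q (b_pr_q A i0 i1)) (b_pr_q A i0 (@i2 0)))
    = b_add (etrans (b_pr_q A i0 i1) (esym (b_add_q (b_pr_q A i1 (@i2 0)))));
  b_addC : b_add (b_pr_q A i1 (@i0 1)) = b_plus A;
  b_addr0 : b_add (b_q_zero_q A) = idm (b_tot A)
}.

Lemma b_pr_sq (X : category) (A B : bundle X) (f : b_tot A ~> b_tot B)
    (g : b_base A ~> b_base B) (e : f ;; b_q B = b_q A ;; g) n (i j : 'I_n) :
  (b_pr A i ;; f) ;; b_q B = (b_pr A j ;; f) ;; b_q B.
Proof. by rewrite -!compA e !compA (b_pr_q A i j). Qed.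

Record is_bundle_morphism (X : category) (A B : bundle X)
    (f : b_tot A ~> b_tot B) (g : b_base A ~> b_base B) : Prop :=
  IsBundleMorphism {
  bm_sq : f ;; b_q B = b_q A ;; g;
  bm_plus : b_plus A ;; f = b_add (b_pr_sq bm_sq i0 (@i1 0));
  bm_zero : b_zero A ;; f = g ;; b_zero B
}.
Arguments is_bundle_morphism {X} A B f g.

Lemma map_plus_q (X Y : category) (F : functor X Y) (A : bundle X) :
  fmap F (b_plus A) ;; fmap F (b_q A) = fmap F (b_powq A 2).
Proof. by rewrite -fmapM b_plus_q. Qed.

Lemma map_zero_q (X Y : category) (F : functor X Y) (A : bundle X) :
  fmap F (b_zero A) ;; fmap F (b_q A) = idm (F (b_base A)).
Proof. by rewrite -fmapM b_zero_q fmap1. Qed.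

Definition map_bundle (X Y : category) (F : functor X Y) (A : bundle X)
    (FP : forall n, is_fibre_power (fmap F (b_q A)) (fmap F (b_powq A n))
                      (fun i => fmap F (b_pr A i))) : bundle Y :=
  @Bundle Y (F (b_tot A)) (F (b_base A)) (fmap F (b_q A))
    (fun n => F (b_pow A n)) (fun n => fmap F (b_powq A n))
    (fun n i => fmap F (b_pr A i)) FP
    (fmap F (b_plus A)) (fmap F (b_zero A))
    (map_plus_q F A) (map_zero_q F A).

(** Tangent categories.  [tangent_data] has everything but naturality of [+]
    and the laws on [+], [ell] and [c]; it already asks that the
    fibre powers [T_n M] exist ([k = 0]) and are preserved by every [T^k]. *)

Record tangent_data (X : category) := TangentData {
  T : functor X X;
  p : forall M : X, T M ~> M;
  zero : forall M : X, M ~> T M;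
  ell : forall M : X, T M ~> T (T M);
  flip : forall M : X, T (T M) ~> T (T M);
  p_nat : forall (M N : X) (f : M ~> N), fmap T f ;; p N = p M ;; f;
  zero_nat : forall (M N : X) (f : M ~> N), f ;; zero N = zero M ;; fmap T f;
  ell_nat : forall (M N : X) (f : M ~> N),
    fmap T f ;; ell N = ell M ;; fmap T (fmap T f);
  flip_nat : forall (M N : X) (f : M ~> N),
    fmap T (fmap T f) ;; flip N = flip M ;; fmap T (fmap T f);
  Tn : nat -> X -> X;
  Tn_q : forall n (M : X), Tn n M ~> M;
  Tn_pr : forall n (M : X), 'I_n -> (Tn n M ~> T M);
  TnP : forall k n (M : X),
    is_fibre_power (fmap (iter_functor T k) (p M))
      (fmap (iter_functor T k) (Tn_q n M))
      (fun i => fmap (iter_functor T k) (@Tn_pr n M i));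
  plus : forall M : X, Tn 2 M ~> T M;
  plus_p : forall M : X, plus M ;; p M = Tn_q 2 M;
  zero_p : forall M : X, zero M ;; p M = idm M
}.
Arguments T {X} t.
Arguments p {X} t M.
Arguments zero {X} t M.
Arguments ell {X} t M.
Arguments flip {X} t M.
Arguments Tn {X} t n M.
Arguments Tn_q {X} t n M.
Arguments Tn_pr {X} t {n} M i.
Arguments TnP {X} t k n M.
Arguments plus {X} t M.
Arguments plus_p {X} t M.
Arguments zero_p {X} t M.

Definition tan_bundle (X : category) (t : tangent_data X) (M : X) : bundle X :=
  @Bundle X (T t M) M (p t M)
    (fun n => Tn t n M) (fun n => Tn_q t n M) (fun n i => Tn_pr t M i)
    (fun n => TnP t 0 n M) (plus t M) (zero t M) (plus_p t M) (zero_p t M).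

Definition T_tan_bundle (X : category) (t : tangent_data X) (M : X) :
    bundle X :=
  @map_bundle X X (T t) (tan_bundle t M) (fun n => TnP t 1 n M).

Lemma Tn_map_q (X : category) (t : tangent_data X) n (M N : X) (f : M ~> N) i :
  (Tn_pr t M i ;; fmap (T t) f) ;; p t N = Tn_q t n M ;; f.
Proof. by rewrite -compA p_nat compA (fp_sq (TnP t 0 n M)). Qed.

Definition Tn_map (X : category) (t : tangent_data X) n (M N : X)
    (f : M ~> N) : Tn t n M ~> Tn t n N :=
  fp_lift (TnP t 0 n N) (@Tn_map_q X t n M N f).

Lemma vlift_q (X : category) (t : tangent_data X) (M : X)
    (e : ell t M ;; fmap (T t) (p t M) = p t M ;; zero t M) :
  (Tn_pr t M (@i0 1) ;; ell t M) ;; fmap (T t) (p t M)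
  = (Tn_pr t M i1 ;; zero t (T t M)) ;; fmap (T t) (p t M).
Proof.
rewrite -!compA e -zero_nat !compA.
by rewrite (fp_sq (TnP t 0 2 M) i0) (fp_sq (TnP t 0 2 M) i1).
Qed.

(** The map v = <pi_0 ell, pi_1 0_TM> T(+) : T_2 M -> T^2 M; the pairing is
    into T (T_2 M), seen as the fibre product of two copies of T (p_M). *)
Definition vlift (X : category) (t : tangent_data X) (M : X)
    (e : ell t M ;; fmap (T t) (p t M) = p t M ;; zero t M) :
    Tn t 2 M ~> T t (T t M) :=
  @b_pair X (T_tan_bundle t M) _ _ _ (vlift_q e) ;; fmap (T t) (plus t M).

Record is_tangent (X : category) (t : tangent_data X) := IsTangent {
  plus_nat : forall (M N : X) (f : M ~> N),
    Tn_map t 2 f ;; plus t N = plus t M ;; fmap (T t) f;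
  p_additive : forall M : X, is_additive (tan_bundle t M);
  ell_additive : forall M : X,
    is_bundle_morphism (tan_bundle t M) (T_tan_bundle t M)
      (ell t M) (zero t M);
  flip_additive : forall M : X,
    is_bundle_morphism (T_tan_bundle t M) (tan_bundle t (T t M))
      (flip t M) (idm (T t M));
  flip_flip : forall M : X, flip t M ;; flip t M = idm (T t (T t M));
  ell_flip : forall M : X, ell t M ;; flip t M = ell t M;
  ell_ell : forall M : X,
    ell t M ;; fmap (T t) (ell t M) = ell t M ;; ell t (T t M);
  flip_braid : forall M : X,
    fmap (T t) (flip t M) ;; flip t (T t M) ;; fmap (T t) (flip t M)
    = flip t (T t M) ;; fmap (T t) (flip t M) ;; flip t (T t M);
  ell_flip_flip : forall M : X,
    ell t (T t M) ;; fmap (T t) (flip t M) ;; flip t (T t M)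
    = flip t M ;; fmap (T t) (ell t M);
  vlift_pullback : forall k (M : X),
    let Tk := iter_functor (T t) k in
    is_pullback (fmap Tk (fmap (T t) (p t M))) (fmap Tk (zero t M))
      (fmap Tk (vlift (bm_sq (ell_additive M))))
      (fmap Tk (Tn_pr t M i0 ;; p t M))
}.

Record cartesian_tangent_category := CartesianTangentCategory {
  ctc_cat :> category;
  ctc_data : tangent_data ctc_cat;
  ctc_tangent : is_tangent ctc_data;
  one : ctc_cat;
  oneP : is_terminal one;
  prd : ctc_cat -> ctc_cat -> ctc_cat;
  pi0 : forall A B, prd A B ~> A;
  pi1 : forall A B, prd A B ~> B;
  prdP : forall A B, is_product (pi0 A B) (pi1 A B);
  T_oneP : is_terminal (T ctc_data one);
  T_prdP : forall A B,
    is_product (fmap (T ctc_data) (pi0 A B)) (fmap (T ctc_data) (pi1 A B))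
}.
Arguments one {c}.
Arguments prd {c} A B.
Arguments pi0 {c A B}.
Arguments pi1 {c A B}.

Definition tan (K : cartesian_tangent_category) : functor K K :=
  T (ctc_data K).

Notation "A × B" := (prd A B) (at level 40, left associativity) : cat_scope.
Notation "'𝕋' A" := (fobj (tan _) A)
  (at level 10, A at level 9) : cat_scope.

Definition tmap (K : cartesian_tangent_category) (A B : K) (f : A ~> B) :
  𝕋 A ~> 𝕋 B := fmap (tan K) f.

Definition to1 (K : cartesian_tangent_category) (A : K) : A ~> one :=
  bang (oneP K) A.

Definition pairm (K : cartesian_tangent_category) (Y A B : K)
    (f : Y ~> A) (g : Y ~> B) : Y ~> A × B := prod_lift (prdP A B) f g.

Notation "⟨ f , g ⟩" := (pairm f g) : cat_scope.

Definition cross (K : cartesian_tangent_category) (A B A' B' : K)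
    (f : A ~> A') (g : B ~> B') : A × B ~> A' × B' := ⟨pi0 ;; f, pi1 ;; g⟩.

Notation "f ⊗ g" := (cross f g) (at level 40, left associativity) : cat_scope.

(** The identification of TA x TB with T(A x B). *)
Definition mu (K : cartesian_tangent_category) (A B : K) :
  𝕋 A × 𝕋 B ~> 𝕋 (A × B) := prod_lift (T_prdP A B) pi0 pi1.
Arguments mu {K A B}.

Definition assoc (K : cartesian_tangent_category) (A B C : K) :
  (A × B) × C ~> A × (B × C) := ⟨pi0 ;; pi0, ⟨pi0 ;; pi1, pi1⟩⟩.
Arguments assoc {K A B C}.

Definition swap (K : cartesian_tangent_category) (A B : K) :
  A × B ~> B × A := ⟨pi1, pi0⟩.
Arguments swap {K A B}.

(** Vector fields and dynamical systems. *)

Record vector_field (K : cartesian_tangent_category) (M : K) := VectorField {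
  vf :> M ~> 𝕋 M;
  vf_p : vf ;; p (ctc_data K) M = idm M
}.

Record dynamical_system (K : cartesian_tangent_category) := DynamicalSystem {
  ds_obj :> K;
  ds_vf : vector_field ds_obj;
  ds_pt : one ~> ds_obj
}.
Arguments ds_vf {K} d.
Arguments ds_pt {K} d.

(** [gamma] is a solution, with respect to the dynamical system [C], of the
    parameterized dynamical system [(M, V, g)]. *)
Definition is_solution (K : cartesian_tangent_category)
    (C : dynamical_system K) (M X : K) (V : vector_field M) (g : X ~> M)
    (gamma : C × X ~> M) : Prop :=
  ⟨to1 X ;; ds_pt C, idm X⟩ ;; gamma = g /\
  (ds_vf C ⊗ zero (ctc_data K) X) ;; mu ;; tmap gamma = gamma ;; V.

Record curve_object (K : cartesian_tangent_category) := CurveObject {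
  co_ds :> dynamical_system K;
  co_preinitial : forall (M X : K) (V : vector_field M) (g : X ~> M)
      (gamma gamma' : co_ds × X ~> M),
    is_solution V g gamma -> is_solution V g gamma' -> gamma = gamma';
  co_comm : ds_vf co_ds ;; tmap (ds_vf co_ds) ;; flip (ctc_data K) co_ds
            = ds_vf co_ds ;; tmap (ds_vf co_ds);
  co_sigma : co_ds × co_ds ~> co_ds;
  co_sigmaP : is_solution (ds_vf co_ds) (idm co_ds) co_sigma
}.

Definition complete (K : cartesian_tangent_category) (C : curve_object K)
    (M : K) (V : vector_field M) : Prop :=
  forall (X : K) (g : X ~> M), exists gamma : C × X ~> M, is_solution V g gamma.
Arguments complete {K} C {M} V.

(** [gamma] is the solution of [V], i.e. the flow associated to [V]; it is
    unique by [co_preinitial]. *)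
Definition is_flow_of (K : cartesian_tangent_category) (C : curve_object K)
    (M : K) (V : vector_field M) (gamma : C × M ~> M) : Prop :=
  is_solution V (idm M) gamma.

Definition vf_commute (K : cartesian_tangent_category) (M : K)
    (V1 V2 : vector_field M) : Prop :=
  V1 ;; tmap V2 ;; flip (ctc_data K) M = V2 ;; tmap V1.

Definition vf_invariant (K : cartesian_tangent_category) (C : curve_object K)
    (M : K) (V : vector_field M) (gamma : C × M ~> M) : Prop :=
  gamma ;; V = (zero (ctc_data K) C ⊗ V) ;; mu ;; tmap gamma.

Definition flows_commute (K : cartesian_tangent_category) (C : curve_object K)
    (M : K) (gamma1 gamma2 : C × M ~> M) : Prop :=
  (swap ⊗ idm M) ;; assoc ;; (idm C ⊗ gamma1) ;; gamma2
  = assoc ;; (idm C ⊗ gamma2) ;; gamma1.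

(* Main.v *)
Require Import Defs.
From mathcomp Require Import all_boot.
(* [compA] is associativity in a category, not that of functions. *)
Import Defs.
Local Open Scope cat_scope.

Set Implicit Arguments.
Unset Strict Implicit.
Unset Printing Implicit Defensive.

(** Every equivalence comes from differentiating an identity between maps out
    of [C × X], and conversely from uniqueness of solutions (preinitiality of
    the curve object).

    Invariance and commutation of vector fields.  Let [gamma] be the flow of
    [V], and [W] a vector field on the same object.  The map [T(V)c] is a
    vector field on [TM], and [gamma W] and [(0 x W)T(gamma)] are the two
    sides of the invariance of [W] under [gamma].  Both start at [W]; the
    derivative of the first in the time variable is [gamma V T(W)]
    ([solution_postcomp]), and the second always satisfies the differential
    equation of [T(V)c] ([derivative_pushforward]).  So if [V] and [W] commute,
    both solve the system [(TM, T(V)c, W)] and are equal; conversely, if they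
    are equal, comparing their derivatives at time [c_0] gives
    [V T(W) = W T(V)c] ([vf_invariantP]).  As [cc = 1], commutation is
    symmetric, so that invariance is symmetric too.

    Invariance and commutation of flows.  Commutation of the flows says that
    [(s, (t, x)) |-> gamma2 (t, gamma1 (s, x))] and
    [(s, (t, x)) |-> gamma1 (s, gamma2 (t, x))] agree.  Both start at [gamma2];
    the second solves [V1] in the time [s] ([solution_reparam]), and the
    derivative of the first is [(0 x V1)T(gamma2)] evaluated at
    [(t, gamma1 (s, x))] ([derivative_flow_then]).  If [V1] is invariant
    under [gamma2], the first is therefore also a solution of [V1]; conversely,
    if the two agree, comparing derivatives at [s = c_0] gives invariance
    ([flows_commuteP]). *)

(** * Products and their tangents *)

Section Products.
Variable K : cartesian_tangent_category.
Implicit Types A B M X Y Z : K.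

Lemma pairm0 Y A B (f : Y ~> A) (g : Y ~> B) : ⟨f, g⟩ ;; pi0 = f.
Proof. exact: prod_lift0. Qed.

Lemma pairm1 Y A B (f : Y ~> A) (g : Y ~> B) : ⟨f, g⟩ ;; pi1 = g.
Proof. exact: prod_lift1. Qed.

Lemma prd_ext Y A B (u v : Y ~> A × B) :
  u ;; pi0 = v ;; pi0 -> u ;; pi1 = v ;; pi1 -> u = v.
Proof.
move=> e0 e1; rewrite (prod_uniq (prdP A B) e0 e1).
by apply/esym/prod_uniq.
Qed.

Lemma comp_pairm Z Y A B (h : Z ~> Y) (f : Y ~> A) (g : Y ~> B) :
  h ;; ⟨f, g⟩ = ⟨h ;; f, h ;; g⟩.
Proof. by apply: prd_ext; rewrite -compA ?pairm0 ?pairm1. Qed.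

Lemma pairm_cross Y A B A' B' (f : Y ~> A) (g : Y ~> B) (h : A ~> A')
    (k : B ~> B') : ⟨f, g⟩ ;; (h ⊗ k) = ⟨f ;; h, g ;; k⟩.
Proof. by rewrite comp_pairm !compA pairm0 pairm1. Qed.

Lemma pairm_pi A B : ⟨pi0, pi1⟩ = idm (A × B).
Proof. by apply: prd_ext; rewrite comp1m ?pairm0 ?pairm1. Qed.

Lemma crossM A B A' B' A'' B'' (f : A ~> A') (g : B ~> B') (f' : A' ~> A'')
    (g' : B' ~> B'') : (f ⊗ g) ;; (f' ⊗ g') = (f ;; f') ⊗ (g ;; g').
Proof. by rewrite /cross pairm_cross !compA. Qed.

Lemma to1E X (u : X ~> one) : u = to1 X.
Proof. exact: bang_uniq. Qed.

Lemma tmapM A B M (f : A ~> B) (g : B ~> M) :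
  tmap (f ;; g) = tmap f ;; tmap g.
Proof. exact: fmapM. Qed.

Lemma tmap1 A : tmap (idm A) = idm (𝕋 A).
Proof. exact: fmap1. Qed.

Lemma zero_natE A B (f : A ~> B) :
  f ;; zero (ctc_data K) B = zero (ctc_data K) A ;; tmap f.
Proof. exact: zero_nat. Qed.

Lemma flip_natE A B (f : A ~> B) :
  tmap (tmap f) ;; flip (ctc_data K) B
  = flip (ctc_data K) A ;; tmap (tmap f).
Proof. exact: flip_nat. Qed.

Lemma flipK A :
  flip (ctc_data K) A ;; flip (ctc_data K) A = idm (𝕋 (𝕋 A)).
Proof. exact: flip_flip (ctc_tangent K) A. Qed.

Lemma flip_p A :
  flip (ctc_data K) A ;; p (ctc_data K) (𝕋 A) = tmap (p (ctc_data K) A).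
Proof.
by have [e _ _] := flip_additive (ctc_tangent K) A; rewrite /= compm1 in e.
Qed.

Lemma tmap_zero_flip A :
  tmap (zero (ctc_data K) A) ;; flip (ctc_data K) A
  = zero (ctc_data K) (𝕋 A).
Proof.
by have [_ _ e] := flip_additive (ctc_tangent K) A; rewrite /= comp1m in e.
Qed.

Lemma zero_flip A :
  zero (ctc_data K) (𝕋 A) ;; flip (ctc_data K) A
  = tmap (zero (ctc_data K) A).
Proof. by rewrite -tmap_zero_flip -compA flipK compm1. Qed.

Lemma tprd_ext Y A B (u v : Y ~> 𝕋 (A × B)) :
  u ;; tmap pi0 = v ;; tmap pi0 -> u ;; tmap pi1 = v ;; tmap pi1 -> u = v.
Proof.
move=> e0 e1; rewrite (prod_uniq (T_prdP A B) e0 e1).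
by apply/esym/prod_uniq.
Qed.

Lemma mu_pi0 A B : @mu K A B ;; tmap pi0 = pi0.
Proof. exact: prod_lift0. Qed.

Lemma mu_pi1 A B : @mu K A B ;; tmap pi1 = pi1.
Proof. exact: prod_lift1. Qed.

Lemma tpair_mu A B : ⟨tmap pi0, tmap pi1⟩ ;; mu = idm (𝕋 (A × B)).
Proof.
by apply: tprd_ext; rewrite comp1m -compA ?mu_pi0 ?mu_pi1 ?pairm0 ?pairm1.
Qed.

Lemma ttprd_ext Y A B (u v : Y ~> 𝕋 (𝕋 (A × B))) :
  u ;; tmap (tmap pi0) = v ;; tmap (tmap pi0) ->
  u ;; tmap (tmap pi1) = v ;; tmap (tmap pi1) -> u = v.
Proof.
move=> e0 e1.
suff e : u ;; tmap ⟨tmap pi0, tmap pi1⟩ = v ;; tmap ⟨tmap pi0, tmap pi1⟩.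
  rewrite -[u]compm1 -[v]compm1 -tmap1 -tpair_mu tmapM.
  by rewrite (compA u) (compA v) e.
by apply: tprd_ext; rewrite -!compA -!tmapM ?pairm0 ?pairm1.
Qed.

(** The product of maps into tangent objects, as a map into [T(A' x B')]. *)
Definition tcross {A B A' B' : K} (f : A ~> 𝕋 A') (g : B ~> 𝕋 B') :
  A × B ~> 𝕋 (A' × B') := (f ⊗ g) ;; mu.

Lemma tcross0 A B A' B' (f : A ~> 𝕋 A') (g : B ~> 𝕋 B') :
  tcross f g ;; tmap pi0 = pi0 ;; f.
Proof. by rewrite /tcross -compA mu_pi0 pairm0. Qed.

Lemma tcross1 A B A' B' (f : A ~> 𝕋 A') (g : B ~> 𝕋 B') :
  tcross f g ;; tmap pi1 = pi1 ;; g.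
Proof. by rewrite /tcross -compA mu_pi1 pairm1. Qed.

Lemma cross_tcross A B A' B' A'' B'' (h : A ~> A') (k : B ~> B')
    (f : A' ~> 𝕋 A'') (g : B' ~> 𝕋 B'') :
  (h ⊗ k) ;; tcross f g = tcross (h ;; f) (k ;; g).
Proof. by rewrite /tcross compA crossM. Qed.

Lemma tcross_tmap A B A' B' A'' B'' (f : A ~> 𝕋 A') (g : B ~> 𝕋 B')
    (h : A' ~> A'') (k : B' ~> B'') :
  tcross f g ;; tmap (h ⊗ k) = tcross (f ;; tmap h) (g ;; tmap k).
Proof.
apply: tprd_ext; rewrite -compA -tmapM ?tcross0 ?tcross1 ?pairm0 ?pairm1.
  by rewrite tmapM !compA tcross0.
by rewrite tmapM !compA tcross1.
Qed.

(** Maps into second tangents of products are compared componentwise, and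
    [c] acts componentwise by naturality. *)
Lemma tcross_exchange A B (A1 A2 B1 B2 A' B' : K)
    (f1 : A ~> 𝕋 A1) (g1 : B ~> 𝕋 B1) (h1 : A1 ~> 𝕋 A') (k1 : B1 ~> 𝕋 B')
    (f2 : A ~> 𝕋 A2) (g2 : B ~> 𝕋 B2) (h2 : A2 ~> 𝕋 A') (k2 : B2 ~> 𝕋 B') :
  f1 ;; tmap h1 = f2 ;; tmap h2 ;; flip (ctc_data K) A' ->
  g1 ;; tmap k1 = g2 ;; tmap k2 ;; flip (ctc_data K) B' ->
  tcross f1 g1 ;; tmap (tcross h1 k1)
  = tcross f2 g2 ;; tmap (tcross h2 k2) ;; flip (ctc_data K) (A' × B').
Proof.
move=> ef eg; apply: ttprd_ext.
  rewrite -!compA -flip_natE (compA (tmap _)) -!tmapM !tcross0 !tmapM.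
  by rewrite !compA !tcross0 -!compA ef !compA.
rewrite -!compA -flip_natE (compA (tmap _)) -!tmapM !tcross1 !tmapM.
by rewrite !compA !tcross1 -!compA eg !compA.
Qed.

End Products.

(** * Solutions and their derivatives *)

Section Flows.
Variables (K : cartesian_tangent_category) (C : curve_object K).
Implicit Types M N X Y : K.

(** The initial time [<!c_0, 1>]. *)
Definition at0 (X : K) : X ~> C × X := ⟨to1 X ;; ds_pt C, idm X⟩.

(** The derivative [(c_1 x 0)T(u)] of [u] in the time variable. *)
Definition ddt {X M : K} (u : C × X ~> M) : C × X ~> 𝕋 M :=
  tcross (ds_vf C) (zero (ctc_data K) X) ;; tmap u.

Lemma at0_cross X Y (f : X ~> Y) : at0 X ;; (idm C ⊗ f) = f ;; at0 Y.
Proof.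
rewrite /at0 pairm_cross comp_pairm !compm1 comp1m compA.
by rewrite (to1E (f ;; to1 Y)).
Qed.

Lemma ddt_comp X M N (u : C × X ~> M) (f : M ~> N) :
  ddt (u ;; f) = ddt u ;; tmap f.
Proof. by rewrite /ddt tmapM compA. Qed.

Lemma ddt_cross X Y M (f : Y ~> X) (u : C × X ~> M) :
  ddt ((idm C ⊗ f) ;; u) = (idm C ⊗ f) ;; ddt u.
Proof.
rewrite /ddt tmapM (compA _ (tmap (idm C ⊗ f))) tcross_tmap.
by rewrite (compA (idm C ⊗ f)) cross_tcross tmap1 compm1 comp1m zero_natE.
Qed.

Lemma solutionE X M (V : vector_field M) (g : X ~> M) (u : C × X ~> M) :
  is_solution (C := C) V g u <-> at0 X ;; u = g /\ ddt u = u ;; V.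
Proof. by []. Qed.

Lemma solution_reparam X Y M (V : vector_field M) (g : X ~> M)
    (u : C × X ~> M) (f : Y ~> X) :
  is_solution (C := C) V g u ->
  is_solution (C := C) V (f ;; g) ((idm C ⊗ f) ;; u).
Proof.
move=> /solutionE[e0 e1]; apply/solutionE; split.
  by rewrite compA at0_cross -compA e0.
by rewrite ddt_cross e1 compA.
Qed.

Lemma solution_postcomp X M N (V : vector_field M) (g : X ~> M)
    (u : C × X ~> M) (f : M ~> N) :
  is_solution (C := C) V g u ->
  at0 X ;; (u ;; f) = g ;; f /\ ddt (u ;; f) = u ;; (V ;; tmap f).
Proof.
by move=> /solutionE[e0 e1]; rewrite compA e0 ddt_comp e1 compA.
Qed.

Lemma tangent_lift_p M (V : vector_field M) :
  tmap V ;; flip (ctc_data K) M ;; p (ctc_data K) (𝕋 M) = idm (𝕋 M).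
Proof. by rewrite -compA flip_p -tmapM vf_p tmap1. Qed.

(** The tangent lift [T(V)c] of [V], a vector field on [TM]. *)
Definition tangent_lift {M : K} (V : vector_field M) : vector_field (𝕋 M) :=
  VectorField (tangent_lift_p V).

(** The map [(0 x W)T(gamma)], i.e. the derivative of the time-[t] map of
    [gamma] along [W]. *)
Definition pushforward {M N : K} (gamma : C × M ~> N) (W : M ~> 𝕋 M) :
    C × M ~> 𝕋 N :=
  tcross (zero (ctc_data K) C) W ;; tmap gamma.

Lemma pushforward_at0 M (gamma : C × M ~> M) (W : M ~> 𝕋 M) :
  at0 M ;; gamma = idm M -> at0 M ;; pushforward gamma W = W.
Proof.
move=> e; rewrite /pushforward.
have -> : at0 M ;; (tcross (zero (ctc_data K) C) W ;; tmap gamma)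
    = W ;; tmap (at0 M) ;; tmap gamma.
  rewrite compA; congr (_ ;; _).
  apply: tprd_ext; rewrite -compA ?tcross0 ?tcross1 -compA -tmapM.
    rewrite !compA !pairm0 -compA zero_natE !tmapM !compA.
    congr (_ ;; _).
    (* both sides are maps to T1, which is terminal *)
    by rewrite (bang_uniq (T_oneP K) (to1 M ;; _))
               (bang_uniq (T_oneP K) (W ;; _)).
  by rewrite !compA !pairm1 tmap1 compm1 comp1m.
by rewrite -compA -tmapM e tmap1 compm1.
Qed.

(** Mixed second derivatives agree up to [c]: differentiating [gamma] along
    [W] and then in time is, up to [c], differentiating it in time, which
    gives [gamma V], and then along [W]. *)
Lemma derivative_pushforward M (V W : vector_field M) (gamma : C × M ~> M) :
  ddt gamma = gamma ;; V ->
  ddt (pushforward gamma W) = pushforward gamma W ;; tangent_lift V.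
Proof.
move=> e; pose D := tcross (ds_vf C) (zero (ctc_data K) M).
have e' : tmap gamma ;; (tmap V ;; flip (ctc_data K) M)
    = tmap D ;; flip (ctc_data K) (C × M) ;; tmap (tmap gamma).
  by rewrite compA -tmapM -e /ddt -/D tmapM -compA flip_natE compA.
rewrite /= /ddt /pushforward -/D tmapM -(compA _ (tmap gamma)) e'.
rewrite (compA D) (compA _ _ (tmap (tmap gamma))); congr (_ ;; _).
rewrite (compA _ (tmap D)).
apply: tcross_exchange.
  by rewrite -zero_natE -compA zero_flip.
by rewrite -compA tmap_zero_flip zero_natE.
Qed.

(** * Invariance under a flow *)

Lemma vf_invariantE M (W : vector_field M) (gamma : C × M ~> M) :
  vf_invariant W gamma <-> gamma ;; W = pushforward gamma W.
Proof. by []. Qed.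

Lemma vf_commute_sym M (V W : vector_field M) :
  vf_commute V W -> vf_commute W V.
Proof. by rewrite /vf_commute => <-; rewrite -!compA flipK compm1. Qed.

Lemma vf_invariantP M (V W : vector_field M) (gamma : C × M ~> M) :
  is_flow_of V gamma -> vf_invariant W gamma <-> vf_commute W V.
Proof.
move=> flow; have /solutionE[e0 e1] := flow.
have [d0 d1] := solution_postcomp W flow.
have p0 := pushforward_at0 W e0.
have p1 := derivative_pushforward W e1.
rewrite comp1m in d0; split=> [/vf_invariantE inv | com].
  have : at0 M ;; ddt (gamma ;; W) = at0 M ;; ddt (pushforward gamma W).
    by rewrite inv.
  rewrite d1 p1 /vf_commute (compA (at0 M)) e0 comp1m (compA (at0 M)) p0.
  by rewrite /= compA => ->.
apply/vf_invariantE.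
apply: (co_preinitial (V := tangent_lift V) (g := W)); apply/solutionE.
  by split=> //; rewrite d1 -com /= !compA.
by split.
Qed.

(** * Commuting flows *)

(** The map [(s, (t, x)) |-> gamma2 (t, gamma1 (s, x))]; the other composite
    of the flows is [(1 x gamma2)gamma1]. *)
Definition flow_then {M : K} (gamma1 gamma2 : C × M ~> M) :
    C × (C × M) ~> M :=
  ⟨pi1 ;; pi0, (idm C ⊗ pi1) ;; gamma1⟩ ;; gamma2.

Lemma flows_commuteE M (gamma1 gamma2 : C × M ~> M) :
  flows_commute gamma1 gamma2
  <-> flow_then gamma1 gamma2 = (idm C ⊗ gamma2) ;; gamma1.
Proof.
(* the inverse of the associator *)
pose unassoc : C × (C × M) ~> (C × C) × M :=
  ⟨⟨pi0, pi1 ;; pi0⟩, pi1 ;; pi1⟩.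
have assocK : assoc ;; unassoc = idm ((C × C) × M).
  rewrite /unassoc /assoc !(comp_pairm, compA, pairm0, pairm1).
  by rewrite -comp_pairm pairm_pi compm1 pairm_pi.
have unassocK : unassoc ;; assoc = idm (C × (C × M)).
  rewrite /unassoc /assoc !(comp_pairm, compA, pairm0, pairm1).
  by rewrite -comp_pairm pairm_pi compm1 pairm_pi.
have thenE : (swap ⊗ idm M) ;; assoc ;; (idm C ⊗ gamma1) ;; gamma2
    = assoc ;; flow_then gamma1 gamma2.
  rewrite /flow_then /assoc /swap /cross.
  by rewrite !(comp_pairm, compA, pairm0, pairm1, compm1).
rewrite /flows_commute thenE -compA; split=> [e | ->] //.
by rewrite -[LHS]comp1m -[RHS]comp1m -unassocK -!compA e.
Qed.

Lemma flow_then_at0 M (gamma1 gamma2 : C × M ~> M) :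
  at0 M ;; gamma1 = idm M ->
  at0 (C × M) ;; flow_then gamma1 gamma2 = gamma2.
Proof.
move=> e; rewrite /flow_then compA comp_pairm !compA at0_cross.
by rewrite -(compA pi1) e pairm1 comp1m compm1 pairm_pi comp1m.
Qed.

Lemma derivative_flow_then M (V1 : vector_field M)
    (gamma1 gamma2 : C × M ~> M) :
  ddt gamma1 = gamma1 ;; V1 ->
  ddt (flow_then gamma1 gamma2)
  = ⟨pi1 ;; pi0, (idm C ⊗ pi1) ;; gamma1⟩ ;; pushforward gamma2 V1.
Proof.
move=> e; rewrite /flow_then ddt_comp /pushforward compA; congr (_ ;; _).
apply: tprd_ext; rewrite -?ddt_comp -compA ?tcross0 ?tcross1 !compA.
  rewrite !pairm0 ddt_comp /ddt tcross1 -compA -zero_natE.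
  by rewrite !compA.
by rewrite !pairm1 ddt_cross e !compA.
Qed.

Lemma flows_commuteP M (V1 : vector_field M) (gamma1 gamma2 : C × M ~> M) :
  is_flow_of V1 gamma1 ->
  flows_commute gamma1 gamma2 <-> vf_invariant V1 gamma2.
Proof.
move=> flow; have /solutionE[e0 e1] := flow.
have sol := solution_reparam gamma2 flow.
rewrite compm1 in sol.
have f0 := flow_then_at0 gamma2 e0.
have f1 := derivative_flow_then gamma2 e1.
split=> [/flows_commuteE com | /vf_invariantE inv].
  have /solutionE[s0 s1] := sol.
  apply/vf_invariantE.
  have : at0 (C × M) ;; ddt (flow_then gamma1 gamma2)
       = at0 (C × M) ;; (flow_then gamma1 gamma2 ;; V1).
    by rewrite com s1.
  rewrite (compA _ _ V1) f0 => <-.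
  rewrite f1 compA comp_pairm !compA at0_cross.
  by rewrite -(compA pi1) e0 pairm1 comp1m compm1 pairm_pi comp1m.
apply/flows_commuteE.
apply: (co_preinitial (V := V1) (g := gamma2)) sol.
by apply/solutionE; split=> //; rewrite f1 -inv compA.
Qed.

End Flows.

Theorem theorem4p33 (K : cartesian_tangent_category) (C : curve_object K)
    (M : K) (V1 V2 : vector_field M) (gamma1 gamma2 : C × M ~> M)
    (complete1 : complete C V1) (flow1 : is_flow_of V1 gamma1)
    (complete2 : complete C V2) (flow2 : is_flow_of V2 gamma2) :
  [/\ flows_commute gamma1 gamma2 <-> vf_invariant V1 gamma2,
      vf_invariant V1 gamma2 <-> vf_invariant V2 gamma1 &
      vf_invariant V2 gamma1 <-> vf_commute V1 V2].
Proof.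
have inv1 := vf_invariantP V1 flow2.
have inv2 := vf_invariantP V2 flow1.
have comE : vf_commute V1 V2 <-> vf_commute V2 V1.
  by split; apply: vf_commute_sym.
split; first exact: flows_commuteP flow1.
- exact: iff_trans inv1 (iff_trans comE (iff_sym inv2)).
- exact: iff_trans inv2 (iff_sym comE).
Qed.
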